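(* Let $p>3$ be a prime and $a\in\mathbb Z_p$ with $a\not\equiv0,\pm1,-2\pmod p$. Then $$\sum_{k=0}^{p-3}\binom ak\binom{-1-a}k\binom{2k}k\frac1{4^k(k+2)}\equiv\frac13\sum_{k=0}^{p-2}\binom ak\binom{-1-a}k\binom{2k}k\frac1{4^k(k+1)}-\frac1{3(a-1)(a+2)}S_p(a)$$ $$\equiv\frac{a^2+a-3}{3(a-1)(a+2)}S_p(a)+\frac{a+1}{3a}S_p(a+1)\pmod{p^3}.$$
   Context: For a prime $p$, $\mathbb Z_p$ denotes the set of rational numbers whose denominator is not divisible by $p$, and congruences modulo powers of $p$ are between elements of $\mathbb Z_p$ (the difference divided by that power of $p$ lies in $\mathbb Z_p$). For rational $a$ and integer $k\ge0$, $\binom ak=a(a-1)\cdots(a-k+1)/k!$. Define $S_n(a)=\sum_{k=0}^{n-1}\binom ak\binom{-1-a}k\binom{2k}k\frac1{4^k}$ for $n\ge1$. *)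

(* Defs.v *)
From HB Require Import structures.
From mathcomp Require Import all_boot all_order all_algebra.

Set Implicit Arguments.
Unset Strict Implicit.
Unset Printing Implicit Defensive.

Import Order.TTheory GRing.Theory Num.Theory.

Local Open Scope ring_scope.

(* Z_p (Z localized at p): rationals whose reduced denominator is prime to p *)
Definition Zloc (p : nat) : {pred rat} := [pred x | ~~ (p %| `|denq x|)%N].

Definition eqmodp (p m : nat) (x y : rat) : bool :=
  [&& x \in Zloc p, y \in Zloc p & (x - y) / p%:R ^+ m \in Zloc p].

Definition gbinom (a : rat) (k : nat) : rat :=
  (\prod_(i < k) (a - i%:R)) / k`!%:R.

Definition Sn (n : nat) (a : rat) : rat :=
  \sum_(0 <= k < n)
     gbinom a k * gbinom (-1 - a) k * 'C(2 * k, k)%:R * (1 / 4 ^+ k).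

(* Main.v *)
(** Let t_k(a) be the k-th summand of S_n(a). It satisfies
    2(k+1)^3 t_(k+1)(a) = (2k+1)(k-a)(k+a+1) t_k(a) and
    (a+1-k) t_k(a+1) = (a+1+k) t_k(a). The first relation makes
    k^2/(k+1) t_k(a) a telescoping antidifference of a combination of t_k/(k+2),
    t_k/(k+1) and t_k; with the second one, k^2 (t_k(a) + t_k(a+1)) is one for
    t_k(a)/(k+1), t_k(a) and t_k(a+1). Both congruences are thus exact
    identities up to multiples of t_(p-2)(a), t_(p-1)(a) and t_(p-1)(a+1), and
    those are divisible by p^3: the hypotheses on a make each of the three
    binomial factors divisible by p. *)

Require Import Defs.
From HB Require Import structures.
From mathcomp Require Import all_boot all_order all_algebra.
From mathcomp Require Import ring zify.

Set Implicit Arguments.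
Unset Strict Implicit.
Unset Printing Implicit Defensive.

Import Order.TTheory GRing.Theory Num.Theory.

Local Open Scope ring_scope.

(** * Recurrences for the binomials and for the summand, in [k] and in [a] *)

Lemma gbinomS (a : rat) (k : nat) :
  gbinom a k.+1 = gbinom a k * (a - k%:R) / k.+1%:R.
Proof.
rewrite /gbinom big_ord_recr /= factS natrM.
have k1 : k.+1%:R != 0 :> rat by rewrite pnatr_eq0.
have kf : k`!%:R != 0 :> rat by rewrite pnatr_eq0 -lt0n fact_gt0.
by rewrite -natr1 in k1 *; field; rewrite kf k1.
Qed.

Lemma gbinom_shift (a : rat) (k : nat) :
  (a + 1 - k%:R) * gbinom (a + 1) k = (a + 1) * gbinom a k.
Proof.
elim: k => [|k IHk]; first by rewrite /gbinom !big_ord0 subr0.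
rewrite !gbinomS -natr1.
have k1 : k%:R + 1 != 0 :> rat by rewrite natr1 pnatr_eq0.
have -> : (a + 1 - (k%:R + 1)) * (gbinom (a + 1) k * (a + 1 - k%:R) / (k%:R + 1))
   = (a - k%:R) * ((a + 1 - k%:R) * gbinom (a + 1) k) / (k%:R + 1) by field.
by rewrite IHk; field.
Qed.

(** Two absorption identities, from row 2k+2 to 2k+1 and from row 2k+1 to 2k, joined by the symmetry
    C(2k+1, k) = C(2k+1, k+1). *)
Lemma central_binS (k : nat) :
  ((k.+1) * 'C(2 * k.+1, k.+1) = 2 * (2 * k).+1 * 'C(2 * k, k))%N.
Proof.
have e1 := mul_bin_diag (2 * k.+1) k.
have e2 := mul_bin_diag (2 * k).+1 k.
have e3 : 'C((2 * k).+1, k) = 'C((2 * k).+1, k.+1).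
  by rewrite -(@bin_sub _ k.+1); [congr 'C(_, _); lia | lia].
rewrite (_ : (2 * k.+1).-1 = (2 * k).+1) in e1; last by lia.
rewrite /= in e2.
rewrite -e1 e3.
have -> : (2 * k.+1 * 'C((2 * k).+1, k.+1) = 2 * (k.+1 * 'C((2 * k).+1, k.+1)))%N by ring.
by rewrite -e2 mulnA.
Qed.

Definition cterm (a : rat) (k : nat) : rat :=
  gbinom a k * gbinom (-1 - a) k * 'C(2 * k, k)%:R * (1 / 4 ^+ k).

Lemma ctermS (a : rat) (k : nat) :
  2 * (k%:R + 1) ^+ 3 * cterm a k.+1
  = (2 * k%:R + 1) * (k%:R - a) * (k%:R + a + 1) * cterm a k.
Proof.
rewrite /cterm !gbinomS -(@natr1 _ k) (exprS 4).
have k1 : k%:R + 1 != 0 :> rat by rewrite natr1 pnatr_eq0.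
have p4 : (4 : rat) ^+ k != 0 by rewrite expf_neq0.
have /(congr1 (fun m => m%:R : rat)) := central_binS k.
rewrite !natrM -(@natr1 _ k) -(@natr1 _ (2 * k)%N) natrM => cE.
have -> : 'C(2 * k.+1, k.+1)%:R
    = 2 * (2 * k%:R + 1) * 'C(2 * k, k)%:R / (k%:R + 1) :> rat.
  by apply: (canRL (mulfK k1)); rewrite mulrC cE.
by field; rewrite p4 k1.
Qed.

(** [gbinom_shift] is used at [a] and at [-1 - (a + 1)], since the second binomial of the summand
    moves down when [a] moves up. Each use brings a factor [a + 1] up to sign, and one of them has
    to be cancelled. *)
Lemma cterm_shift (a : rat) (k : nat) : a + 1 != 0 ->
  (a + 1 - k%:R) * cterm (a + 1) k = (a + 1 + k%:R) * cterm a k.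
Proof.
move=> a1; apply: (mulfI a1); rewrite /cterm.
have := gbinom_shift (-1 - (a + 1)) k.
rewrite (_ : -1 - (a + 1) + 1 = -1 - a); last by ring.
have := gbinom_shift a k.
move: (gbinom (a + 1) k) (gbinom a k) (gbinom (-1 - a) k)
  (gbinom (-1 - (a + 1)) k) => x y z w.
move=> e1 e2; move: (_%:R) (1 / _) k%:R e1 e2 => c f m e1 e2.
have -> : (a + 1) * ((a + 1 - m) * (x * w * c * f))
    = - ((a + 1 - m) * x) * ((-1 - a) * w) * c * f by ring.
by rewrite e1 -e2; ring.
Qed.

(** * Exact summation identities with their boundary terms *)

Lemma sum_cterm_div_add2 (a : rat) (n : nat) : (a - 1) * (a + 2) != 0 ->
  \sum_(0 <= k < n) (cterm a k / (k%:R + 2))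
  = 1 / 3 * \sum_(0 <= k < n) (cterm a k / (k%:R + 1))
    - 1 / (3 * (a - 1) * (a + 2)) * \sum_(0 <= k < n) cterm a k
    - 2 * n%:R ^+ 2 / (3 * (a - 1) * (a + 2) * (n%:R + 1)) * cterm a n.
Proof.
rewrite mulf_eq0 negb_or => /andP[a1 a2].
(* Telescoping as an induction: the boundary term vanishes at 0 through its factor [n ^ 2], and once
   [ctermS] has eliminated [cterm a n.+1] its increment is a rational identity. *)
elim: n => [|n IHn].
  by rewrite !big_geq // expr0n /= !mulr0 !mul0r !subr0.
rewrite !big_nat_recr //= IHn -(@natr1 _ n).
have n1 : n%:R + 1 != 0 :> rat by rewrite natr1 pnatr_eq0.
have n2 : n%:R + 2 != 0 :> rat by rewrite -natrD pnatr_eq0 addn2.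
have n3 : n%:R + 1 + 1 != 0 :> rat by rewrite -addrA.
have -> : cterm a n.+1 = (2 * n%:R + 1) * (n%:R - a) * (n%:R + a + 1) * cterm a n
            / (2 * (n%:R + 1) ^+ 3).
  by apply: (canRL (mulfK _)); rewrite ?mulf_neq0 ?expf_neq0 // mulrC ctermS.
by field; rewrite ?n1 ?n2 ?n3 ?a1 ?a2.
Qed.

Lemma sum_cterm_div_add1 (a : rat) (n : nat) : a != 0 -> a + 1 != 0 ->
  \sum_(0 <= k < n) (cterm a k / (k%:R + 1))
  = \sum_(0 <= k < n) cterm a k
    + (a + 1) / a * \sum_(0 <= k < n) cterm (a + 1) k
    + n%:R ^+ 2 / (a * (a + 1)) * (cterm a n + cterm (a + 1) n).
Proof.
move=> a0 a1; elim: n => [|n IHn].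
  by rewrite !big_geq // expr0n /= !(mulr0, mul0r) !addr0.
rewrite !big_nat_recr //= IHn -(@natr1 _ n).
have n1 : n%:R + 1 != 0 :> rat by rewrite natr1 pnatr_eq0.
have e1 : cterm a n.+1 = (2 * n%:R + 1) * (n%:R - a) * (n%:R + a + 1) * cterm a n
            / (2 * (n%:R + 1) ^+ 3).
  by apply: (canRL (mulfK _)); rewrite ?mulf_neq0 ?expf_neq0 // mulrC ctermS.
have es := cterm_shift n a1.
(* The factor [n - (a + 1)] given by [ctermS] is absorbed by the shift relation, which leaves a
   multiple of [cterm a n]. *)
have e2 : cterm (a + 1) n.+1
    = - ((2 * n%:R + 1) * (n%:R + a + 2) * (a + 1 + n%:R) * cterm a n)
            / (2 * (n%:R + 1) ^+ 3).
  apply: (canRL (mulfK _)); rewrite ?mulf_neq0 ?expf_neq0 // mulrC ctermS.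
  by rewrite -(mulrA _ _ (cterm a n)) -es; ring.
(* The shift relation multiplied by [a + 1 + n]. Solving for [cterm (a + 1) n] instead would divide
   by [a + 1 - n], which may be zero. *)
have e3 : (a + 1) ^+ 2 * cterm (a + 1) n
    = n%:R ^+ 2 * cterm (a + 1) n + (a + 1 + n%:R) ^+ 2 * cterm a n.
  apply/eqP; rewrite -subr_eq0; apply/eqP.
  have -> : (a + 1 + n%:R) ^+ 2 * cterm a n
    = (a + 1 + n%:R) * ((a + 1 + n%:R) * cterm a n) by ring.
  by rewrite -es; ring.
have e4 : (a + 1) / a * cterm (a + 1) n
    = (a + 1) ^+ 2 * cterm (a + 1) n / (a * (a + 1)) by field; rewrite a0 a1.
by rewrite e1 e2 [in RHS](mulrDr ((a + 1) / a)) e4 e3; field; rewrite n1 a1 a0.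
Qed.

(** * Arithmetic of the ring of p-integral rationals *)

Lemma Zloc_frac (p : nat) (n d : int) :
  ~~ (p %| `|d|)%N -> n%:~R / d%:~R \in Zloc p.
Proof.
move=> pd; have d0 : d != 0 by apply: contraNneq pd => ->; rewrite dvdn0.
rewrite inE; apply: contra pd => /dvdn_trans; apply.
set x := n%:~R / d%:~R.
(* By Gauss's lemma this cross-multiplication makes the reduced denominator divide [d]. *)
have e : numq x * d = n * denq x.
  apply: (@intr_inj rat); rewrite !intrM.
  have d0' : d%:~R != 0 :> rat by rewrite intr_eq0.
  have q0 : (denq x)%:~R != 0 :> rat by rewrite intr_eq0 denq_neq0.
  have <- : x * (denq x)%:~R = (numq x)%:~R by rewrite -{1}(divq_num_den x) divfK.
  by rewrite mulrAC /x divfK.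
have : (denq x %| numq x * d)%Z by rewrite e dvdz_mull.
rewrite Gauss_dvdzr; last by have := coprime_num_den x; rewrite coprime_sym.
by [].
Qed.

Lemma ZlocP (p : nat) (x : rat) :
  reflect (exists n d : int, ~~ (p %| `|d|)%N /\ x = n%:~R / d%:~R) (x \in Zloc p).
Proof.
apply: (iffP idP) => [xp|[n [d [pd ->]]]]; last exact: Zloc_frac.
by exists (numq x), (denq x); split; rewrite ?divq_num_den.
Qed.

Lemma Zloc_int (p : nat) (n : int) : prime p -> n%:~R \in Zloc p.
Proof.
move=> pp; rewrite -[n%:~R]divr1; apply: (@Zloc_frac p n 1).
by rewrite dvdn1 gtn_eqF ?prime_gt1.
Qed.

Lemma Zloc_nat (p n : nat) : prime p -> n%:R \in Zloc p.
Proof. exact: (@Zloc_int p n). Qed.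

Lemma Zloc_natV (p n : nat) : ~~ (p %| n)%N -> n%:R^-1 \in Zloc p.
Proof. by move=> pn; rewrite -[_^-1]mul1r; apply: (@Zloc_frac p 1 n). Qed.

Lemma ZlocN (p : nat) (x : rat) : x \in Zloc p -> - x \in Zloc p.
Proof. by rewrite !inE denqN. Qed.

Lemma ZlocM (p : nat) (x y : rat) : prime p ->
  x \in Zloc p -> y \in Zloc p -> x * y \in Zloc p.
Proof.
move=> pp /ZlocP[n [d [pd ->]]] /ZlocP[m [e [pe ->]]].
rewrite mulf_div -!intrM; apply: Zloc_frac.
by rewrite abszM Euclid_dvdM // negb_or pd.
Qed.

Lemma ZlocD (p : nat) (x y : rat) : prime p ->
  x \in Zloc p -> y \in Zloc p -> x + y \in Zloc p.
Proof.
move=> pp /ZlocP[n [d [pd ->]]] /ZlocP[m [e [pe ->]]].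
have nz c : ~~ (p %| `|c|)%N -> c%:~R != 0 :> rat.
  by apply: contraNneq => /eqP; rewrite intr_eq0 => /eqP ->; rewrite dvdn0.
rewrite addf_div ?nz // -!intrM -intrD; apply: Zloc_frac.
by rewrite abszM Euclid_dvdM // negb_or pd.
Qed.

Lemma ZlocB (p : nat) (x y : rat) : prime p ->
  x \in Zloc p -> y \in Zloc p -> x - y \in Zloc p.
Proof. by move=> pp xp yp; rewrite ZlocD ?ZlocN. Qed.

Lemma ZlocX (p : nat) (x : rat) (n : nat) : prime p ->
  x \in Zloc p -> x ^+ n \in Zloc p.
Proof.
move=> pp xp; elim: n => [|n IHn]; first exact: Zloc_nat 1 pp.
by rewrite exprS ZlocM.
Qed.

Lemma Zloc_sum (p m n : nat) (F : nat -> rat) : prime p ->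
  (forall k, (m <= k < n)%N -> F k \in Zloc p) ->
  \sum_(m <= k < n) F k \in Zloc p.
Proof.
move=> pp Fp; rewrite big_nat; elim/big_ind: _ => //.
- exact: Zloc_nat 0 pp.
- by move=> x y; apply: ZlocD.
Qed.

(** An element outside the maximal ideal is a unit: its numerator is prime to [p] and can serve as a
    denominator. *)
Lemma Zloc_inv (p : nat) (x : rat) : prime p ->
  x \in Zloc p -> x / p%:R \notin Zloc p -> x^-1 \in Zloc p.
Proof.
move=> pp /ZlocP[n [d [pd ->]]]; have [pn|pn _] := boolP (p %| `|n|)%N.
  have /dvdzP[m ->] : (p %| n)%Z by [].
  have p0 : p%:R != 0 :> rat by rewrite pnatr_eq0 -lt0n prime_gt0.
  by rewrite intrM mulrAC mulfK // Zloc_frac.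
by rewrite invf_div Zloc_frac.
Qed.

Lemma eqmodp_inv (p : nat) (a c : rat) : prime p ->
  a \in Zloc p -> c \in Zloc p -> ~~ eqmodp p 1 a c -> (a - c)^-1 \in Zloc p.
Proof.
move=> pp ap cp; rewrite /eqmodp ap cp /= expr1; apply: Zloc_inv => //.
exact: ZlocB.
Qed.

Lemma Zloc_residue (p : nat) (a : rat) : prime p -> a \in Zloc p ->
  exists2 r : nat, (r < p)%N & eqmodp p 1 a r%:R.
Proof.
move=> pp ap; have /ZlocP[n [d [pd aE]]] := ap.
have d0 : d%:~R != 0 :> rat.
  by apply: contraNneq pd => /eqP; rewrite intr_eq0 => /eqP ->; rewrite dvdn0.
have p0 : p%:R != 0 :> rat by rewrite pnatr_eq0 -lt0n prime_gt0.
have pz : p%:Z != 0 by rewrite -lt0n prime_gt0.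
(* Bezout makes [v] an inverse of the denominator [d] modulo [p], so the residue sought is [n * v]
   modulo [p]. *)
have [[u v] /= uv] : exists uv, uv.1 * p%:Z + uv.2 * d = 1.
  by apply/coprimezP; rewrite /coprimez /gcdz /= -[_ == _]/(coprime p `|d|) prime_coprime.
have : (0 <= (n * v %% p)%Z)%R by rewrite modz_ge0.
have := @ltz_pmod (n * v) p; rewrite ltz_nat prime_gt0 // => /(_ isT).
have := divz_eq (n * v) p.
case: (n * v %% p)%Z => // r nvE; rewrite ltz_nat => rp _; exists r => //.
rewrite /eqmodp ap Zloc_nat //= expr1.
have -> : (a - r%:R) / p%:R = (n * u + (n * v %/ p)%Z * d)%:~R / d%:~R.
  have nvE' : n%:~R * v%:~R = ((n * v %/ p)%Z)%:~R * p%:R + r%:R :> rat.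
    by move/(congr1 (intr : int -> rat)): nvE; rewrite intrD !intrM.
  have uv' : u%:~R * p%:R + v%:~R * d%:~R = 1 :> rat.
    by rewrite -[RHS]/(1%:~R) -uv intrD !intrM.
  have nE : n%:~R / d%:~R = n%:~R * u%:~R * p%:R / d%:~R + n%:~R * v%:~R :> rat.
    transitivity (n%:~R * (u%:~R * p%:R + v%:~R * d%:~R) / d%:~R : rat).
      by rewrite uv' mulr1.
    by field.
  by rewrite aE nE nvE' intrD !intrM; field; rewrite d0 p0.
exact: Zloc_frac.
Qed.

Lemma Zloc_prod (p n : nat) (P : pred 'I_n) (F : 'I_n -> rat) : prime p ->
  (forall i, F i \in Zloc p) -> \prod_(i | P i) F i \in Zloc p.
Proof.
move=> pp Fp; elim/big_ind: _ => //; first exact: Zloc_nat 1 pp.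
by move=> x y; apply: ZlocM.
Qed.

(** * Divisibility of the binomial factors and of the summand by powers of [p] *)

Lemma prime_ndvd_fact (p k : nat) : prime p -> (k < p)%N -> ~~ (p %| k`!)%N.
Proof.
move=> pp; elim: k => [|k IHk] kp; first by rewrite dvdn1 gtn_eqF ?prime_gt1.
by rewrite factS Euclid_dvdM // negb_or IHk ?(ltnW kp) // gtnNdvd.
Qed.

Lemma gbinom_Zloc (p k : nat) (a : rat) : prime p -> (k < p)%N ->
  a \in Zloc p -> gbinom a k \in Zloc p.
Proof.
move=> pp kp ap; rewrite ZlocM ?Zloc_natV ?prime_ndvd_fact //.
by apply: Zloc_prod => // i; rewrite ZlocB ?Zloc_nat.
Qed.

(** The factor [a - i] occurs in the numerator and supplies [p], while [k!] is prime to [p]. *)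
Lemma gbinom_dvd (p k i : nat) (a : rat) : prime p -> (i < k < p)%N ->
  a \in Zloc p -> (a - i%:R) / p%:R \in Zloc p -> gbinom a k / p%:R \in Zloc p.
Proof.
move=> pp /andP[ik kp] ap aip.
rewrite mulrAC ZlocM ?Zloc_natV ?prime_ndvd_fact //.
rewrite (bigD1 (Ordinal ik)) //= mulrAC ZlocM //.
by apply: Zloc_prod => // j; rewrite ZlocB ?Zloc_nat.
Qed.

(** The prime divides [(2k)!] but not [k!]. *)
Lemma central_bin_dvd (p k : nat) : prime p -> (k < p <= 2 * k)%N ->
  'C(2 * k, k)%:R / p%:R \in Zloc p.
Proof.
move=> pp /andP[kp pk].
have : (p %| 'C(2 * k, k) * (k`! * (2 * k - k)`!))%N.
  by rewrite bin_fact ?leq_pmull // dvdn_fact // prime_gt0.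
rewrite (_ : (2 * k - k = k)%N); last by lia.
rewrite !Euclid_dvdM // (negbTE (prime_ndvd_fact pp kp)) !orbF => /dvdnP[m ->].
by rewrite natrM mulfK ?Zloc_nat // pnatr_eq0 -lt0n prime_gt0.
Qed.

Lemma cterm_Zloc (p k : nat) (a : rat) : prime p -> (2 < p)%N -> (k < p)%N ->
  a \in Zloc p -> cterm a k \in Zloc p.
Proof.
move=> pp p2 kp ap; have p1 := Zloc_nat 1 pp.
have ap' : -1 - a \in Zloc p by rewrite ZlocB ?ZlocN.
have p4 : ~~ (p %| 4 ^ k)%N.
  by rewrite -[4%N]/(2 ^ 2)%N -expnM Euclid_dvdX // gtnNdvd.
have := gbinom_Zloc pp kp ap; have := gbinom_Zloc pp kp ap'.
rewrite /cterm -natrX; move: (gbinom a k) (gbinom _ k) => x y yp xp.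
by rewrite !(ZlocM pp) ?Zloc_nat ?Zloc_natV.
Qed.

(** The excluded classes of -1, ..., -m are the residues p-m, ..., p-1. The remaining [r] indexes a
    factor of the numerator of [gbinom a (p - m)]. *)
Lemma Zloc_residue_lt (p m : nat) (a : rat) : prime p -> (m < p)%N ->
  a \in Zloc p ->
  (forall j, (0 < j <= m)%N -> (a + j%:R) / p%:R \notin Zloc p) ->
  exists2 r : nat, (r < p - m)%N & (a - r%:R) / p%:R \in Zloc p.
Proof.
move=> pp mp ap am; have [r rp] := Zloc_residue pp ap.
rewrite /eqmodp expr1 => /and3P[_ _ ar]; exists r => //.
rewrite ltnNge; apply/negP => pmr.
have p0 : p%:R != 0 :> rat by rewrite pnatr_eq0 -lt0n prime_gt0.
have /negP[] := am (p - r)%N ltac:(lia).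
rewrite natrB ?(ltnW rp) //.
have -> : (a + (p%:R - r%:R)) / p%:R = (a - r%:R) / p%:R + 1 by field.
by rewrite ZlocD ?(Zloc_nat 1).
Qed.

(** Each of the three binomials supplies one [p]. The two families of hypotheses exclude the classes
    of -1, ..., -m for [a] and for [-1 - a] respectively; [2 * m <= p] serves the central
    binomial. *)
Lemma cterm_dvd (p m : nat) (a : rat) : prime p -> (2 < p)%N ->
  (0 < m)%N -> (2 * m <= p)%N -> a \in Zloc p ->
  (forall j, (0 < j <= m)%N -> (a + j%:R) / p%:R \notin Zloc p) ->
  (forall j, (0 < j <= m)%N -> (a + 1 - j%:R) / p%:R \notin Zloc p) ->
  cterm a (p - m) / p%:R ^+ 3 \in Zloc p.
Proof.
move=> pp p2 m0 mp ap am aNm; have p1 := Zloc_nat 1 pp.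
have mltp : (m < p)%N by lia.
have kp : (p - m < p)%N by lia.
have ap' : -1 - a \in Zloc p by rewrite ZlocB ?ZlocN.
have [r rk ar] := Zloc_residue_lt pp mltp ap am.
have [|s sk asp] := Zloc_residue_lt pp mltp ap'.
  move=> j /aNm; apply: contra => /ZlocN; rewrite -mulNr.
  by rewrite (_ : - (-1 - a + j%:R) = a + 1 - j%:R) //; ring.
have p4 : ~~ (p %| 4 ^ (p - m))%N.
  by rewrite -[4%N]/(2 ^ 2)%N -expnM Euclid_dvdX // gtnNdvd.
have p0 : p%:R != 0 :> rat by rewrite pnatr_eq0 -lt0n prime_gt0.
have -> : cterm a (p - m) / p%:R ^+ 3
    = (gbinom a (p - m) / p%:R) * (gbinom (-1 - a) (p - m) / p%:R)
      * ('C(2 * (p - m), p - m)%:R / p%:R) * (4 ^ (p - m))%:R^-1.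
  rewrite /cterm -natrX; field.
  by rewrite p0 pnatr_eq0 expn_eq0.
apply: ZlocM (Zloc_natV p4) => //; apply: ZlocM => //; first apply: ZlocM => //.
- by apply: gbinom_dvd ar; rewrite ?rk.
- by apply: gbinom_dvd asp; rewrite ?sk.
- by apply: central_bin_dvd; rewrite // kp; lia.
Qed.

(** Integrality of [x] is inherited from [y] and the difference, so only right-hand sides need to be
    checked. *)
Lemma eqmodp_of_sub (p m : nat) (x y : rat) : prime p ->
  y \in Zloc p -> (x - y) / p%:R ^+ m \in Zloc p -> eqmodp p m x y.
Proof.
move=> pp yp xyp; rewrite /eqmodp yp xyp !andbT.
have p0 : p%:R ^+ m != 0 :> rat by rewrite expf_neq0 ?pnatr_eq0 -?lt0n ?prime_gt0.
rewrite -[x](subrK y) -[x - y](divfK p0).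
by apply: ZlocD yp => //; apply: ZlocM (ZlocX _ _ _); rewrite ?Zloc_nat.
Qed.

(** * The two congruences modulo the cube of [p] *)

Theorem theorem8p1 (p : nat) (a : rat)
    (p_prime : prime p) (p_gt3 : (3 < p)%N)
    (a_Zp : a \in Zloc p)
    (a_n0 : ~~ eqmodp p 1 a 0) (a_n1 : ~~ eqmodp p 1 a 1)
    (a_nN1 : ~~ eqmodp p 1 a (-1)) (a_nN2 : ~~ eqmodp p 1 a (-2)) :
  eqmodp p 3
    (\sum_(0 <= k < (p - 3).+1)
        gbinom a k * gbinom (-1 - a) k * 'C(2 * k, k)%:R
          * (1 / (4 ^+ k * (k%:R + 2))))
    (1 / 3 * (\sum_(0 <= k < (p - 2).+1)
        gbinom a k * gbinom (-1 - a) k * 'C(2 * k, k)%:R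
          * (1 / (4 ^+ k * (k%:R + 1))))
      - 1 / (3 * (a - 1) * (a + 2)) * Sn p a)
  /\
  eqmodp p 3
    (1 / 3 * (\sum_(0 <= k < (p - 2).+1)
        gbinom a k * gbinom (-1 - a) k * 'C(2 * k, k)%:R
          * (1 / (4 ^+ k * (k%:R + 1))))
      - 1 / (3 * (a - 1) * (a + 2)) * Sn p a)
    ((a ^+ 2 + a - 3) / (3 * (a - 1) * (a + 2)) * Sn p a
      + (a + 1) / (3 * a) * Sn p (a + 1)).
Proof.
have [p_gt2 pE p1E p3E] : [/\ 2 < p, p = (p - 2).+2, p - 1 = (p - 2).+1
    & (p - 3).+1 = p - 2]%N by split; lia.
have [le21 le22 p_gt0] : [/\ 2 * 1 <= p, 2 * 2 <= p & 0 < p]%N by split; lia.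
have ltp k : (k < (p - 2).+1)%N -> (k.+1 < p)%N by lia.
have ndp1 : ~~ (p %| (p - 2).+1)%N by rewrite gtnNdvd //; lia.
have Z0 := Zloc_nat 0 p_prime; have Z1 := Zloc_nat 1 p_prime.
have Z2 := Zloc_nat 2 p_prime; have Z3 := Zloc_nat 3 p_prime.
have V3 : 3^-1 \in Zloc p by rewrite Zloc_natV ?gtnNdvd.
(* Each hypothesis on [a] makes one of [a], [a - 1], [a + 1], [a + 2] a unit, which keeps all later
   coefficients p-integral. *)
have V0 := eqmodp_inv p_prime a_Zp Z0 a_n0; rewrite subr0 in V0.
have V1 := eqmodp_inv p_prime a_Zp Z1 a_n1.
have VN1 := eqmodp_inv p_prime a_Zp (ZlocN Z1) a_nN1; rewrite opprK in VN1.
have VN2 := eqmodp_inv p_prime a_Zp (ZlocN Z2) a_nN2; rewrite opprK in VN2.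
have neq0 c : c \in Zloc p -> ~~ eqmodp p 1 a c -> a - c != 0.
  by move=> cp; apply: contraNneq => ac; rewrite eqmodp_of_sub // ac mul0r.
have n0 := neq0 _ Z0 a_n0; have n1 := neq0 _ Z1 a_n1.
have nN1 := neq0 _ (ZlocN Z1) a_nN1; have nN2 := neq0 _ (ZlocN Z2) a_nN2.
rewrite subr0 in n0; rewrite opprK in nN1; rewrite opprK in nN2.
have ndvd c : c \in Zloc p -> ~~ eqmodp p 1 a c -> (a - c) / p%:R \notin Zloc p.
  by move=> cp; apply: contra => ac; rewrite eqmodp_of_sub // expr1.
have d0 := ndvd _ Z0 a_n0; have d1 := ndvd _ Z1 a_n1.
have dN1 := ndvd _ (ZlocN Z1) a_nN1; have dN2 := ndvd _ (ZlocN Z2) a_nN2.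
rewrite subr0 in d0; rewrite opprK in dN1; rewrite opprK in dN2.
have a1_Zp : a + 1 \in Zloc p by rewrite ZlocD.
(* Here [m = 2], and the excluded classes -1, -2, 0, 1 are exactly the four hypotheses; [2 * 2 <= p]
   comes from [3 < p]. *)
have T2 : cterm a (p - 2) / p%:R ^+ 3 \in Zloc p.
  apply: cterm_dvd => // -[|[|[|//]]] // _.
  - by rewrite addrK.
  - by rewrite (_ : a + 1 - 2 = a - 1); last by ring.
have T1 : cterm a (p - 1) / p%:R ^+ 3 \in Zloc p.
  apply: cterm_dvd => // -[|[|//]] // _.
  by rewrite addrK.
(* With [m = 1] at [a + 1], the classes to exclude for [a] are -2 and -1. *)
have T1' : cterm (a + 1) (p - 1) / p%:R ^+ 3 \in Zloc p.
  apply: cterm_dvd => // -[|[|//]] // _.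
  - by rewrite -addrA.
  - by rewrite addrK.
have Zs k b : (k < p)%N -> b \in Zloc p -> cterm b k \in Zloc p.
  by move=> *; rewrite cterm_Zloc.
rewrite p3E.
have Zd k : (k.+1 < p)%N -> cterm a k / (k%:R + 1) \in Zloc p.
  by move=> kp; rewrite ZlocM ?Zs 1?ltnW // natr1 Zloc_natV ?gtnNdvd.
have SnE n b : Sn n b = \sum_(0 <= k < n) cterm b k by [].
have divE (c : rat) n : \sum_(0 <= k < n) gbinom a k * gbinom (-1 - a) k
      * 'C(2 * k, k)%:R * (1 / (4 ^+ k * (k%:R + c)))
    = \sum_(0 <= k < n) cterm a k / (k%:R + c).
  by apply: eq_bigr => k _; rewrite /cterm !mul1r invfM !mulrA.
rewrite !divE {divE}.
have VZ : 1 / (3 * (a - 1) * (a + 2)) \in Zloc p.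
  by rewrite mul1r !invfM !ZlocM.
have ZS b : b \in Zloc p -> Sn p b \in Zloc p.
  by move=> bp; apply: Zloc_sum => // k kp; apply: Zs.
have ZX : 1 / 3 * (\sum_(0 <= k < (p - 2).+1) cterm a k / (k%:R + 1))
    - 1 / (3 * (a - 1) * (a + 2)) * Sn p a \in Zloc p.
  rewrite ZlocB ?(ZlocM _ VZ) ?ZS // mul1r ZlocM // Zloc_sum // => k kp.
  by apply/Zd/ltp; case/andP: kp.
have Vp : ((p - 2)%:R + 1)^-1 \in Zloc p.
  by rewrite natr1 Zloc_natV.
have np : (p - 2)%:R + 1 != 0 :> rat by rewrite natr1 pnatr_eq0.
have p0 : p%:R != 0 :> rat by rewrite pnatr_eq0 -lt0n.
have Zp2 := Zloc_nat (p - 2) p_prime.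
have SpE b : Sn p b
    = \sum_(0 <= k < p - 2) cterm b k + cterm b (p - 2) + cterm b (p - 1).
  by rewrite SnE [in LHS]pE !big_nat_recr //= -p1E.
have ZY : (a ^+ 2 + a - 3) / (3 * (a - 1) * (a + 2)) * Sn p a
      + (a + 1) / (3 * a) * Sn p (a + 1) \in Zloc p.
  rewrite mul1r in VZ.
  apply: ZlocD => //; apply: ZlocM (ZS _ _) => //; apply: ZlocM => //.
    by rewrite ZlocB ?ZlocD ?ZlocX.
  by rewrite invfM ZlocM.
split; apply: eqmodp_of_sub => //.
(* The identity is taken at [n = p - 2]. The sum with [k + 1] has one more term and [Sn p a] two
   more, so the boundary term and these extra terms are all that remains. *)
- rewrite sum_cterm_div_add2 ?mulf_neq0 // SpE big_nat_recr //=.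
  move: (cterm a (p - 2)) (cterm a (p - 1)) T2 T1 => t2 t1 T2 T1.
  set n := (p - 2)%:R; set c := 1 / (3 * (a - 1) * (a + 2)).
  rewrite (_ : _ / p%:R ^+ 3 =
    (c - 2 * n ^+ 2 * c / (n + 1) - 3^-1 / (n + 1)) * (t2 / p%:R ^+ 3)
    + c * (t1 / p%:R ^+ 3)); last by rewrite /c; field; rewrite ?p0 ?np ?n1 ?nN2.
  have Zn : n ^+ 2 \in Zloc p by apply: ZlocX.
  apply: ZlocD; rewrite ?(ZlocM _ VZ T1) //; apply: ZlocM => //.
  apply: ZlocB; rewrite ?(ZlocM _ V3 Vp) //; apply: ZlocB => //.
  by apply: ZlocM Vp => //; apply: ZlocM VZ => //; apply: ZlocM.
(* The identity is taken at [n = p - 1], one term short of [Sn p]. The coefficients of [Sn p a]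
   match because 1/3 - 1/(3(a-1)(a+2)) = (a^2+a-3)/(3(a-1)(a+2)). *)
- rewrite sum_cterm_div_add1 // !SpE !big_nat_recr //=.
  rewrite -p1E (_ : (p - 1)%:R = (p - 2)%:R + 1); last by rewrite natr1 p1E.
  move: (cterm a (p - 1)) (cterm (a + 1) (p - 1)) T1 T1' => t1 t1' T1 T1'.
  set n := (p - 2)%:R.
  rewrite (_ : _ / p%:R ^+ 3 =
     3^-1 * ((n + 1) ^+ 2 * a^-1 * (a + 1)^-1 * (t1 / p%:R ^+ 3 + t1' / p%:R ^+ 3)
       - t1 / p%:R ^+ 3 - (a + 1) * a^-1 * (t1' / p%:R ^+ 3))); last first.
    by field; rewrite ?p0 ?n0 ?nN1 ?n1 ?nN2.
  have Zn : (n + 1) ^+ 2 \in Zloc p by rewrite ZlocX // ZlocD.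
  apply: ZlocM => //; apply: ZlocB => //; last by apply: ZlocM T1' => //; apply: ZlocM.
  apply: ZlocB => //; apply: ZlocM (ZlocD _ T1 T1') => //.
  by apply: ZlocM VN1 => //; apply: ZlocM.
Qed.
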